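(* Let $\mathcal L_\infty=\mathbb F(E)/(R)$ be the operad governing $L_\infty$-algebras, where $E=\{E(k)\}_{k\ge1}$ with $E(k)$ the one-dimensional sign representation of $\Sigma_k$ spanned by a generator $\ell_k$ of degree $k-2$, and $R(k)$, $k\ge1$, is spanned by \[ \mathcal J ac_k(1,\dots,k):=\sum_{i+j=k+1}\ \sum_{\sigma}\mathrm{sgn}(\sigma)(-1)^{i(j-1)}\,\ell_j\big(\ell_i(\sigma(1),\dots,\sigma(i)),\sigma(i+1),\dots,\sigma(k)\big), \] with $i,j\ge1$ and $\sigma$ running over all $(i,k-i)$-shuffles in $\Sigma_k$. Then the operad $\mathcal L_\infty$ is tight quadratic.
   Context: $\Bbbk$ is a field of characteristic $0$. Operads are unital $\Bbbk$-linear operads $\mathcal P=\{\mathcal P(n)\}_{n\ge1}$ ($\mathcal P(0)=0$) in graded vector spaces, with partial compositions $\circ_i$, unit $e\in\mathcal P(1)$ and right $\Sigma_n$-actions; in endomorphism operads $(f\cdot\sigma)(x_1,\dots,x_n)=\pm f(x_{\sigma^{-1}(1)},\dots,x_{\sigma^{-1}(n)})$. $\mathbb F(E)$ is the free operad on the collection $E$, $(R)$ the operadic ideal generated by $R$. The notation $\ell_j(\ell_i(\sigma(1),\dots,\sigma(i)),\sigma(i+1),\dots,\sigma(k))$ stands for the operation $\ell_j\circ_1\ell_i$ with its inputs permuted so that $x_{\sigma(r)}$ is inserted in its $r$-th input. An $(i,k-i)$-shuffle is $\sigma\in\Sigma_k$ with $\sigma(1)<\cdots<\sigma(i)$ and $\sigma(i+1)<\cdots<\sigma(k)$.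 Multiindices: $\mathbb Z^n$ is ordered componentwise ($\preceq$), $\wedge$ is the componentwise minimum, $\vec p\cdot\sigma=(p_{\sigma(1)},\dots,p_{\sigma(n)})$. For $\vec a\in\mathbb Z^m$, $\vec b\in\mathbb Z^n$: $\vec a\circ_i\vec b:=(a_1,\dots,a_{i-1},b_1+a_i,\dots,b_n+a_i,a_{i+1},\dots,a_m)$ and $[\vec a,\vec b]_{ij}:=(b_1+a_i,\dots,b_{j-1}+a_i,\;a_1+b_j,\dots,a_{i-1}+b_j,\;a_i+b_j-1,\;b_{j+1}+a_i,\dots,b_n+a_i,\;a_{i+1}+b_j,\dots,a_m+b_j)$. A multifiltration $F\mathcal P$ of $\mathcal P$ is a family of graded subspaces $F_{\vec p}\mathcal P(n)\subset\mathcal P(n)$, $n\ge1$, $\vec p\in\mathbb Z^n$, such that: $F_{\vec p'}\mathcal P(n)\subseteq F_{\vec p''}\mathcal P(n)$ if $\vec p'\preceq\vec p''$; $F_{\vec p}\mathcal P(n)\cdot\sigma=F_{\vec p\cdot\sigma}\mathcal P(n)$; $F_{\vec a}\mathcal P(m)\circ_iF_{\vec b}\mathcal P(n)\subseteq F_{\vec a\circ_i\vec b}\mathcal P(m+n-1)$; $e\in F_{(0)}\mathcal P(1)$. It is saturated if $F_{\vec p'}\mathcal P(n)\cap F_{\vec p''}\mathcal P(n)=F_{\vec p'\wedge\vec p''}\mathcal P(n)$ always. Operadic commutators: for $a\in\mathcal P(m)$, $b\in\mathcal P(n)$, $1\le i\le m$, $1\le j\le n$, $[a,b]_{ij}:=(a\circ_ib)\cdot(\tau_{i-1,j-1}\times\mathrm{id}_{m+n-i-j+1})-(-1)^{|a||b|}(b\circ_ja)\cdot(\mathrm{id}_{i+j-1}\times\tau_{m-i,n-j})$,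 where $\tau_{r,s}\in\Sigma_{r+s}$ is the block transposition $\tau_{r,s}(k)=k+r$ for $k\le s$, $\tau_{r,s}(k)=k-s$ for $k>s$. A multifiltration is a D-multifiltration if $[F_{\vec p}\mathcal P(m),F_{\vec q}\mathcal P(n)]_{ij}\subseteq F_{[\vec p,\vec q]_{ij}}\mathcal P(m+n-1)$ for all $\vec p,\vec q,i,j$. For an operad generated by a collection $E$, the standard D-multifiltration $\overline G\mathcal P$ with respect to $E$ is the smallest (componentwise) saturated D-multifiltration with $E(n)\subset \overline G_{(1,\dots,1)}\mathcal P(n)$ for all $n\ge1$. An operad $\mathcal P$ with generating collection $E$ is tight if it has a presentation $\mathcal P=\mathbb F(E)/(R)$ with $R(n)\subset\overline G_{(1,\dots,1)}\mathbb F(E)(n)$ for each $n\ge1$, where $\overline G\mathbb F(E)$ is the standard D-multifiltration of $\mathbb F(E)$ with respect to $E$. It is (tight) quadratic if $R$ in such a presentation lies in the span of composites of two generators. *)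

(* Defs.v *)
From HB Require Import structures.
From mathcomp Require Import all_boot all_order all_algebra all_fingroup.
From mathcomp Require Import boolp zify.

Set Implicit Arguments.
Unset Strict Implicit.
Unset Printing Implicit Defensive.

Import Order.TTheory GRing.Theory Num.Theory.
Local Open Scope ring_scope.

(* Arities are shifted by one, since P(0) = 0: index n : nat stands for arity
   n + 1, so that P n d is the degree d part of P(n + 1), the partial
   compositions go P m * P n -> P (m + n), the symmetric group in question is
   'S_n.+1, and multiindices are {ffun 'I_n.+1 -> int}.  Inputs are numbered
   from 0.

   To avoid casts, an operation whose arity or degree is a sum takes the target
   arity and degree as parameters, together with proofs that they are the
   expected sums (these proofs are irrelevant, nat and int being eqTypes). *)

(* [insubd] falls back to 1 on non-injective functions; the lemmas below show
   that this never happens in the range where the definitions are used. *)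
Definition perm_of_nat (l : nat) (f : nat -> nat) : 'S_l.+1 :=
  insubd (1%g : 'S_l.+1) [ffun r : 'I_l.+1 => inord (f r)].

Lemma perm_of_natE (l : nat) (f : nat -> nat) (r : 'I_l.+1) :
  (forall s : nat, (s <= l)%N -> (f s <= l)%N) ->
  (forall s t : nat, (s <= l)%N -> (t <= l)%N -> f s = f t -> s = t) ->
  perm_of_nat l f r = f r :> nat.
Proof.
move=> fl finj.
have inj : injectiveb [ffun r : 'I_l.+1 => inord (f r) : 'I_l.+1].
  apply/injectiveP => s t; rewrite !ffunE => /(congr1 (@nat_of_ord _)).
  have hs : (s <= l)%N by rewrite -ltnS.
  have ht : (t <= l)%N by rewrite -ltnS.
  by rewrite !inordK ?ltnS ?fl // => /finj h; apply/val_inj/h.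
rewrite /perm_of_nat /insubd insubT /= -pvalE ffunE inordK //.
by rewrite ltnS fl // -ltnS.
Qed.

(* The slot of a (an operation of index m) numbered p <> i becomes the input
   number [outer_slot n i p] of a o_i b, when b has index n; slot number q of b
   becomes input number i + q. *)
Definition outer_slot (n i p : nat) : nat := if (p < i)%N then p else (p + n)%N.

Definition circ_perm_nat (m n : nat) (i : 'I_m.+1)
    (s : 'S_m.+1) (t : 'S_n.+1) (r : nat) : nat :=
  if (r < i)%N then outer_slot n (s i) (s (inord r))
  else if (r <= i + n)%N then (s i + t (inord (r - i)))%N
  else outer_slot n (s i) (s (inord (r - n))).

(* The permutation s o_i t for which (a.s) o_i (b.t) = (a o_{s(i)} b).(s o_i t) *)
Definition circ_perm (m n l : nat) (i : 'I_m.+1)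
    (s : 'S_m.+1) (t : 'S_n.+1) : 'S_l.+1 :=
  perm_of_nat l (circ_perm_nat i s t).

Lemma outer_slot_inj (n i p q : nat) :
  p <> i -> q <> i -> outer_slot n i p = outer_slot n i q -> p = q.
Proof.
by rewrite /outer_slot; case: (ltnP p i) => ?; case: (ltnP q i) => ?; lia.
Qed.

Lemma outer_slot_inner (n i p q : nat) :
  p <> i -> (q <= n)%N -> outer_slot n i p <> (i + q)%N.
Proof. by rewrite /outer_slot; case: (ltnP p i) => ?; lia. Qed.

Lemma circ_permE (m n l : nat) (i : 'I_m.+1) (s : 'S_m.+1) (t : 'S_n.+1)
    (r : 'I_l.+1) :
  (m + n)%N = l -> circ_perm l i s t r = circ_perm_nat i s t r :> nat.
Proof.
move=> mnl; have im : (i <= m)%N by rewrite -ltnS.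
have sm (w : 'I_m.+1) : (s w <= m)%N by rewrite -ltnS.
have tn (w : 'I_n.+1) : (t w <= n)%N by rewrite -ltnS.
have sE (u v : nat) : (u <= m)%N -> (v <= m)%N ->
    s (inord u) = s (inord v) :> nat -> u = v.
  move=> um vm /ord_inj/perm_inj e.
  by rewrite -(@inordK m u) // e inordK.
have siE (u : nat) : (u <= m)%N -> u <> i -> s (inord u) <> s i :> nat.
  by move=> um ui; rewrite -[i]inord_val => /sE-/(_ um im).
have tE (u v : nat) : (u <= n)%N -> (v <= n)%N ->
    t (inord u) = t (inord v) :> nat -> u = v.
  move=> un vn /ord_inj/perm_inj e.
  by rewrite -(@inordK n u) // e inordK.
apply: perm_of_natE => [u ul|u v ul vl]; rewrite /circ_perm_nat.
  rewrite /outer_slot; move: (sm i) (sm (inord u)) (sm (inord (u - n))).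
  by move: (tn (inord (u - i))) => *; do ! case: ifP => ?; lia.
case: (ltnP u i) => u1; last case: (leqP u (i + n)) => u2;
  (case: (ltnP v i) => v1; last case: (leqP v (i + n)) => v2).
- by move=> /outer_slot_inj e; apply: sE; [lia|lia|apply: e; apply: siE; lia].
- by move=> /outer_slot_inner[]; [apply: siE; lia|].
- by move=> /outer_slot_inj e; have := sE u (v - n)%N;
    move=> /(_ _ _ (e _ _)); move: (siE u) (siE (v - n)%N); lia.
- by move=> /esym/outer_slot_inner[]; [apply: siE; lia|].
- by move=> /addnI/tE; lia.
- by move=> /esym/outer_slot_inner[]; [apply: siE; lia|].
- by move=> /outer_slot_inj e; have := sE (u - n)%N v;
    move=> /(_ _ _ (e _ _)); move: (siE v) (siE (u - n)%N); lia.
- by move=> /outer_slot_inner[]; [apply: siE; lia|].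
- move=> /outer_slot_inj e; suff : (u - n)%N = (v - n)%N by lia.
  by apply: sE; [lia|lia|apply: e; apply: siE; lia].
Qed.

(* The block permutation id_o x tau_{r,s} x id of {0, ..., l}, where tau_{r,s}
   sends k to k + r for k < s and to k - s for s <= k < s + r. *)
Definition block_transp_nat (o r s k : nat) : nat :=
  if (k < o)%N then k
  else if (k < o + s)%N then (k + r)%N
  else if (k < o + s + r)%N then (k - s)%N
  else k.

Definition block_transp (l o r s : nat) : 'S_l.+1 :=
  perm_of_nat l (block_transp_nat o r s).

Lemma block_transpE (l o r s : nat) (k : 'I_l.+1) :
  (o + r + s <= l.+1)%N ->
  block_transp l o r s k = block_transp_nat o r s k :> nat.
Proof.
move=> orsl; apply: perm_of_natE; rewrite /block_transp_nat.
  by move=> u ul; do ! case: ifP => ?; lia.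
move=> u v ul vl; case: (ltnP u o) => ?; case: (ltnP v o) => ?;
  case: (ltnP u (o + s)) => ?; case: (ltnP v (o + s)) => ?;
  case: (ltnP u (o + s + r)) => ?; case: (ltnP v (o + s + r)) => ?; lia.
Qed.

Definition koszul (K : fieldType) (d e : int) : K := (-1) ^ (d * e).

(* Right actions: in MathComp (t * s)%g is "t, then s", i.e. the composite
   usually denoted s t. *)
Record collection_axioms (K : fieldType) (E : nat -> int -> lmodType K)
    (coll_act : forall n d, E n d -> 'S_n.+1 -> E n d) : Prop := CollectionAxioms {
  coll_act_linear : forall n d (s : 'S_n.+1), linear (fun x => coll_act n d x s);
  coll_act1 : forall n d (x : E n d), coll_act n d x 1%g = x;
  coll_actM : forall n d (x : E n d) (s t : 'S_n.+1),
    coll_act n d (coll_act n d x s) t = coll_act n d x (t * s)%g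
}.

Record collection (K : fieldType) := Collection {
  coll_sort :> nat -> int -> lmodType K;
  coll_act : forall n d, coll_sort n d -> 'S_n.+1 -> coll_sort n d;
  collP : collection_axioms coll_act
}.

Record operad_axioms (K : fieldType) (P : collection K) (e : P 0%N 0)
    (circ : forall (m n l : nat) (d1 d2 d : int),
       (m + n)%N = l -> d1 + d2 = d -> 'I_m.+1 -> P m d1 -> P n d2 -> P l d) :
    Prop := OperadAxioms {
  op_circ_linearl : forall (m n l : nat) (d1 d2 d : int)
      (h : (m + n)%N = l) (g : d1 + d2 = d)
      (i : 'I_m.+1) (b : P n d2),
    linear (fun a : P m d1 => circ m n l d1 d2 d h g i a b);
  op_circ_linearr : forall (m n l : nat) (d1 d2 d : int)
      (h : (m + n)%N = l) (g : d1 + d2 = d)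
      (i : 'I_m.+1) (a : P m d1),
    linear (fun b : P n d2 => circ m n l d1 d2 d h g i a b);
  op_unitl : forall (n : nat) (d : int) (h : (0 + n)%N = n)
      (g : 0 + d = d) (b : P n d),
    circ 0%N n n 0 d d h g ord0 e b = b;
  op_unitr : forall (m : nat) (d : int) (h : (m + 0)%N = m)
      (g : d + 0 = d) (i : 'I_m.+1) (a : P m d),
    circ m 0%N m d 0 d h g i a e = a;
  op_sequential : forall (m n p l1 l2 l : nat) (d1 d2 d3 e1 e2 f : int)
      (h1 : (m + n)%N = l1) (h2 : (l1 + p)%N = l)
      (h3 : (n + p)%N = l2) (h4 : (m + l2)%N = l)
      (g1 : d1 + d2 = e1) (g2 : e1 + d3 = f)
      (g3 : d2 + d3 = e2) (g4 : d1 + e2 = f)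
      (i : 'I_m.+1) (j : 'I_n.+1) (a : P m d1) (b : P n d2) (c : P p d3),
    circ _ _ _ _ _ _ h2 g2 (inord (i + j)) (circ _ _ _ _ _ _ h1 g1 i a b) c =
    circ _ _ _ _ _ _ h4 g4 i a (circ _ _ _ _ _ _ h3 g3 j b c);
  op_parallel : forall (m n p l1 l2 l : nat) (d1 d2 d3 e1 e2 f : int)
      (h1 : (m + n)%N = l1) (h2 : (l1 + p)%N = l)
      (h3 : (m + p)%N = l2) (h4 : (l2 + n)%N = l)
      (g1 : d1 + d2 = e1) (g2 : e1 + d3 = f)
      (g3 : d1 + d3 = e2) (g4 : e2 + d2 = f)
      (i j : 'I_m.+1) (a : P m d1) (b : P n d2) (c : P p d3),
    (i < j)%N ->
    circ _ _ _ _ _ _ h2 g2 (inord (j + n)) (circ _ _ _ _ _ _ h1 g1 i a b) c =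
    koszul K d2 d3 *:
      circ _ _ _ _ _ _ h4 g4 (inord i) (circ _ _ _ _ _ _ h3 g3 j a c) b;
  op_equivariant : forall (m n l : nat) (d1 d2 d : int)
      (h : (m + n)%N = l) (g : d1 + d2 = d)
      (i : 'I_m.+1) (a : P m d1) (b : P n d2) (s : 'S_m.+1) (t : 'S_n.+1),
    circ m n l d1 d2 d h g i (coll_act a s) (coll_act b t) =
    coll_act (circ m n l d1 d2 d h g (s i) a b) (circ_perm l i s t)
}.

Record operad (K : fieldType) := Operad {
  op_coll :> collection K;
  op_unit : op_coll 0%N 0;
  circ : forall (m n l : nat) (d1 d2 d : int),
    (m + n)%N = l -> d1 + d2 = d ->
    'I_m.+1 -> op_coll m d1 -> op_coll n d2 -> op_coll l d;
  operadP : operad_axioms op_unit circ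
}.
Arguments op_unit {K} P : rename.

Definition is_coll_morphism (K : fieldType) (E E' : collection K)
    (f : forall n d, E n d -> E' n d) : Prop :=
  (forall n d, linear (f n d)) /\
  (forall n d (x : E n d) (s : 'S_n.+1), f n d (coll_act x s) = coll_act (f n d x) s).

Record is_operad_morphism (K : fieldType) (P Q : operad K)
    (f : forall n d, P n d -> Q n d) : Prop := IsOperadMorphism {
  opm_coll : is_coll_morphism f;
  opm_unit : f _ _ (op_unit P) = op_unit Q;
  opm_circ : forall (m n l : nat) (d1 d2 d : int)
      (h : (m + n)%N = l) (g : d1 + d2 = d)
      (i : 'I_m.+1) (a : P m d1) (b : P n d2),
    f _ _ (circ h g i a b) = circ h g i (f _ _ a) (f _ _ b)
}.

Definition is_subspace (K : fieldType) (V : lmodType K) (S : V -> Prop) : Prop :=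
  S 0 /\ forall (c : K) (x y : V), S x -> S y -> S (c *: x + y).

Definition span (K : fieldType) (V : lmodType K) (S : V -> Prop) (x : V) : Prop :=
  forall W : V -> Prop, is_subspace W -> (forall y, S y -> W y) -> W x.

Definition family (K : fieldType) (P : collection K) : Type :=
  forall (n : nat) (d : int), P n d -> Prop.

Definition subfamily (K : fieldType) (P : collection K) (R S : family P) : Prop :=
  forall n d (x : P n d), R n d x -> S n d x.

Record is_ideal (K : fieldType) (P : operad K) (I : family P) : Prop := IsIdeal {
  ideal_subspace : forall n d, is_subspace (I n d);
  ideal_act : forall n d (x : P n d) (s : 'S_n.+1), I n d x -> I n d (coll_act x s);
  ideal_circl : forall (m n l : nat) (d1 d2 d : int)
      (h : (m + n)%N = l) (g : d1 + d2 = d)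
      (i : 'I_m.+1) (a : P m d1) (b : P n d2),
    I m d1 a -> I l d (circ h g i a b);
  ideal_circr : forall (m n l : nat) (d1 d2 d : int)
      (h : (m + n)%N = l) (g : d1 + d2 = d)
      (i : 'I_m.+1) (a : P m d1) (b : P n d2),
    I n d2 b -> I l d (circ h g i a b)
}.

Definition ideal_gen (K : fieldType) (P : operad K) (R : family P) : family P :=
  fun n d x => forall I : family P, is_ideal I -> subfamily R I -> I n d x.

Lemma ideal_gen_is_ideal (K : fieldType) (P : operad K) (R : family P) :
  is_ideal (ideal_gen R).
Proof.
split.
- move=> n d; split=> [I II RI|c x y Ix Iy I II RI].
    by case: (ideal_subspace II n d).
  by case: (ideal_subspace II n d) => _; apply; [apply: Ix|apply: Iy].
- by move=> n d x s Ix I II RI; apply: ideal_act => //; apply: Ix.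
- by move=> m n l d1 d2 d h g i a b Ia I II RI; apply: ideal_circl => //; apply: Ia.
- by move=> m n l d1 d2 d h g i a b Ib I II RI; apply: ideal_circr => //; apply: Ib.
Qed.

(* A set with operations satisfying the axioms of a K-module up to a congruence *)
Record premod (K : fieldType) := Premod {
  pm_sort :> Type;
  pm_rel : pm_sort -> pm_sort -> Prop;
  pm_zero : pm_sort;
  pm_add : pm_sort -> pm_sort -> pm_sort;
  pm_scale : K -> pm_sort -> pm_sort;
  pm_refl : forall x, pm_rel x x;
  pm_sym : forall x y, pm_rel x y -> pm_rel y x;
  pm_trans : forall x y z, pm_rel x y -> pm_rel y z -> pm_rel x z;
  pm_add_cong : forall x x' y y',
    pm_rel x x' -> pm_rel y y' -> pm_rel (pm_add x y) (pm_add x' y');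
  pm_scale_cong : forall c x x',
    pm_rel x x' -> pm_rel (pm_scale c x) (pm_scale c x');
  pm_addA : forall x y z, pm_rel (pm_add x (pm_add y z)) (pm_add (pm_add x y) z);
  pm_addC : forall x y, pm_rel (pm_add x y) (pm_add y x);
  pm_add0 : forall x, pm_rel (pm_add pm_zero x) x;
  pm_addN : forall x, pm_rel (pm_add (pm_scale (-1) x) x) pm_zero;
  pm_scaleA : forall c c' x,
    pm_rel (pm_scale c (pm_scale c' x)) (pm_scale (c * c') x);
  pm_scale1 : forall x, pm_rel (pm_scale 1 x) x;
  pm_scaleDr : forall c x y,
    pm_rel (pm_scale c (pm_add x y)) (pm_add (pm_scale c x) (pm_scale c y));
  pm_scaleDl : forall x c c',
    pm_rel (pm_scale (c + c') x) (pm_add (pm_scale c x) (pm_scale c' x))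
}.

Definition quot (K : fieldType) (M : premod K) : Type :=
  {A : M -> Prop | exists x, A = pm_rel x}.

Definition qpi (K : fieldType) (M : premod K) (x : M) : quot M :=
  exist _ (pm_rel x) (ex_intro _ x erefl).

Definition qrepr (K : fieldType) (M : premod K) (A : quot M) : M :=
  projT1 (cid (projT2 A)).

Lemma qpi_eq (K : fieldType) (M : premod K) (x y : M) :
  qpi x = qpi y <-> pm_rel x y.
Proof.
split=> [[] ->|xy]; first exact: pm_refl.
apply: eq_exist; apply/predeqP => z; split; last exact: pm_trans.
by apply: pm_trans; apply: pm_sym.
Qed.

Lemma qreprK (K : fieldType) (M : premod K) (A : quot M) : qpi (qrepr A) = A.
Proof.
rewrite /qrepr; case: cid => x /= Ax; case: A Ax => A Ae /= Ax.
by apply: eq_exist.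
Qed.

Lemma qrepr_qpi (K : fieldType) (M : premod K) (x : M) : pm_rel (qrepr (qpi x)) x.
Proof. by apply/qpi_eq; rewrite qreprK. Qed.

Lemma qind (K : fieldType) (M : premod K) (S : quot M -> Prop) :
  (forall x, S (qpi x)) -> forall A, S A.
Proof. by move=> h A; rewrite -[A]qreprK. Qed.

Definition qadd (K : fieldType) (M : premod K) (A B : quot M) : quot M :=
  qpi (pm_add (qrepr A) (qrepr B)).
Definition qscale (K : fieldType) (M : premod K) (c : K) (A : quot M) : quot M :=
  qpi (pm_scale c (qrepr A)).
Definition qzero (K : fieldType) (M : premod K) : quot M := qpi (pm_zero M).
Definition qopp (K : fieldType) (M : premod K) : quot M -> quot M := qscale (-1).

Lemma qadd_pi (K : fieldType) (M : premod K) (x y : M) :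
  qadd (qpi x) (qpi y) = qpi (pm_add x y).
Proof. by apply/qpi_eq/pm_add_cong; apply: qrepr_qpi. Qed.

Lemma qscale_pi (K : fieldType) (M : premod K) (c : K) (x : M) :
  qscale c (qpi x) = qpi (pm_scale c x).
Proof. by apply/qpi_eq/pm_scale_cong/qrepr_qpi. Qed.

Lemma qaddA (K : fieldType) (M : premod K) : associative (@qadd K M).
Proof.
by do 3 elim/qind=> ?; rewrite !qadd_pi; apply/qpi_eq/pm_addA.
Qed.
Lemma qaddC (K : fieldType) (M : premod K) : commutative (@qadd K M).
Proof. by do 2 elim/qind=> ?; rewrite !qadd_pi; apply/qpi_eq/pm_addC. Qed.
Lemma qadd0 (K : fieldType) (M : premod K) : left_id (qzero M) (@qadd K M).
Proof. by elim/qind=> x; rewrite qadd_pi; apply/qpi_eq/pm_add0. Qed.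
Lemma qaddN (K : fieldType) (M : premod K) :
  left_inverse (qzero M) (@qopp K M) (@qadd K M).
Proof.
by elim/qind=> x; rewrite /qopp qscale_pi qadd_pi; apply/qpi_eq/pm_addN.
Qed.

HB.instance Definition _ (K : fieldType) (M : premod K) := gen_eqMixin (quot M).
HB.instance Definition _ (K : fieldType) (M : premod K) :=
  gen_choiceMixin (quot M).
HB.instance Definition _ (K : fieldType) (M : premod K) :=
  GRing.isZmodule.Build (quot M)
    (@qaddA K M) (@qaddC K M) (@qadd0 K M) (@qaddN K M).

Lemma qscaleA (K : fieldType) (M : premod K) (c c' : K) (A : quot M) :
  qscale c (qscale c' A) = qscale (c * c') A.
Proof. by elim/qind: A => x; rewrite !qscale_pi; apply/qpi_eq/pm_scaleA. Qed.
Lemma qscale1 (K : fieldType) (M : premod K) : left_id 1 (@qscale K M).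
Proof. by elim/qind=> x; rewrite qscale_pi; apply/qpi_eq/pm_scale1. Qed.
Lemma qscaleDr (K : fieldType) (M : premod K) : right_distributive (@qscale K M) +%R.
Proof.
move=> c; do 2 elim/qind=> ?; rewrite /GRing.add /= !(qscale_pi, qadd_pi).
exact/qpi_eq/pm_scaleDr.
Qed.
Lemma qscaleDl (K : fieldType) (M : premod K) (A : quot M) :
  {morph (@qscale K M)^~ A : c c' / c + c'}.
Proof.
move=> c c'; elim/qind: A => x; rewrite [RHS]/GRing.add /= !(qscale_pi, qadd_pi).
exact/qpi_eq/pm_scaleDl.
Qed.

HB.instance Definition _ (K : fieldType) (M : premod K) :=
  GRing.Zmodule_isLmodule.Build K (quot M)
    (@qscaleA K M) (@qscale1 K M) (@qscaleDr K M) (@qscaleDl K M).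

Lemma qpi_lin (K : fieldType) (M : premod K) (c : K) (x y : M) :
  c *: (qpi x : quot M) + qpi y = qpi (pm_add (pm_scale c x) y).
Proof. by rewrite /GRing.add /GRing.scale /= qscale_pi qadd_pi. Qed.

Lemma qpi_scale (K : fieldType) (M : premod K) (c : K) (x : M) :
  c *: (qpi x : quot M) = qpi (pm_scale c x).
Proof. exact: qscale_pi. Qed.

#[local] Obligation Tactic := idtac.

Inductive term (K : fieldType) (E : collection K) : nat -> int -> Type :=
| Tgen n d : E n d -> term E n d
| Tunit : term E 0 0
| Tact n d : term E n d -> 'S_n.+1 -> term E n d
| Tcirc (m n l : nat) (d1 d2 d : int) : (m + n)%N = l -> d1 + d2 = d ->
    'I_m.+1 -> term E m d1 -> term E n d2 -> term E l d
| Tzero n d : term E n d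
| Tadd n d : term E n d -> term E n d -> term E n d
| Tscale n d : K -> term E n d -> term E n d.
Arguments Tunit {K E}.
Arguments Tzero {K E n d}.

Fixpoint eval (K : fieldType) (E : collection K) (P : operad K)
    (f : forall n d, E n d -> P n d) (n : nat) (d : int) (t : term E n d) :
    P n d :=
  match t in term _ n d return P n d with
  | Tgen _ _ x => f _ _ x
  | Tunit => op_unit P
  | Tact _ _ x s => coll_act (eval f x) s
  | Tcirc _ _ _ _ _ _ h g i x y => circ h g i (eval f x) (eval f y)
  | Tzero _ _ => 0
  | Tadd _ _ x y => eval f x + eval f y
  | Tscale _ _ c x => c *: eval f x
  end.

(* The free operad is the set of terms modulo the identities which hold in all
   operads, for all interpretations of the generators. *)
Definition term_eq (K : fieldType) (E : collection K) (n : nat) (d : int)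
    (t u : term E n d) : Prop :=
  forall (P : operad K) (f : forall n d, E n d -> P n d),
    is_coll_morphism f -> eval f t = eval f u.

Program Definition term_premod (K : fieldType) (E : collection K)
    (n : nat) (d : int) : premod K :=
  @Premod K (term E n d) (@term_eq K E n d) Tzero (@Tadd K E n d)
    (@Tscale K E n d) _ _ _ _ _ _ _ _ _ _ _ _ _.
Next Obligation. by []. Qed.
Next Obligation. by move=> K E n d x y xy P f fE; rewrite xy. Qed.
Next Obligation. by move=> K E n d x y z xy yz P f fE; rewrite xy ?yz. Qed.
Next Obligation. by move=> K E n d x x' y y' xx yy P f fE /=; rewrite xx ?yy. Qed.
Next Obligation. by move=> K E n d c x x' xx P f fE /=; rewrite xx. Qed.
Next Obligation. by move=> K E n d x y z P f fE /=; rewrite addrA. Qed.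
Next Obligation. by move=> K E n d x y P f fE /=; rewrite addrC. Qed.
Next Obligation. by move=> K E n d x P f fE /=; rewrite add0r. Qed.
Next Obligation. by move=> K E n d x P f fE /=; rewrite scaleN1r addNr. Qed.
Next Obligation. by move=> K E n d c c' x P f fE /=; rewrite scalerA. Qed.
Next Obligation. by move=> K E n d x P f fE /=; rewrite scale1r. Qed.
Next Obligation. by move=> K E n d c x y P f fE /=; rewrite scalerDr. Qed.
Next Obligation. by move=> K E n d x c c' P f fE /=; rewrite scalerDl. Qed.

Definition free_sort (K : fieldType) (E : collection K) (n : nat) (d : int) :
  lmodType K := quot (term_premod E n d).

Definition fpi (K : fieldType) (E : collection K) (n : nat) (d : int)
  (t : term E n d) : free_sort E n d := qpi (M := term_premod E n d) t.

Definition frepr (K : fieldType) (E : collection K) (n : nat) (d : int)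
  (x : free_sort E n d) : term E n d := qrepr (M := term_premod E n d) x.

Definition free_act (K : fieldType) (E : collection K) (n : nat) (d : int)
    (x : free_sort E n d) (s : 'S_n.+1) : free_sort E n d :=
  fpi (Tact (frepr x) s).

Definition free_circ (K : fieldType) (E : collection K) (m n l : nat)
    (d1 d2 d : int) (h : (m + n)%N = l) (g : d1 + d2 = d) (i : 'I_m.+1)
    (x : free_sort E m d1) (y : free_sort E n d2) : free_sort E l d :=
  fpi (Tcirc h g i (frepr x) (frepr y)).

Lemma fpi_eq (K : fieldType) (E : collection K) n d (t u : term E n d) :
  fpi t = fpi u <-> term_eq t u.
Proof. exact: (@qpi_eq K (term_premod E n d)). Qed.

Lemma frepr_fpi (K : fieldType) (E : collection K) n d (t : term E n d) :
  term_eq (frepr (fpi t)) t.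
Proof. exact: (@qrepr_qpi K (term_premod E n d)). Qed.

Lemma free_ind (K : fieldType) (E : collection K) n d (S : free_sort E n d -> Prop) :
  (forall t, S (fpi t)) -> forall x, S x.
Proof. exact: (@qind K (term_premod E n d)). Qed.

Lemma fpi_lin (K : fieldType) (E : collection K) n d c (t u : term E n d) :
  c *: fpi t + fpi u = fpi (Tadd (Tscale c t) u).
Proof. exact: (@qpi_lin K (term_premod E n d)). Qed.

Lemma fpi_scale (K : fieldType) (E : collection K) n d c (t : term E n d) :
  c *: fpi t = fpi (Tscale c t).
Proof. exact: (@qpi_scale K (term_premod E n d)). Qed.

Lemma free_act_fpi (K : fieldType) (E : collection K) n d (t : term E n d) s :
  free_act (fpi t) s = fpi (Tact t s).
Proof. by apply/fpi_eq => P f fE /=; rewrite (frepr_fpi t fE). Qed.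

Lemma free_circ_fpi (K : fieldType) (E : collection K) m n l d1 d2 d
    (h : (m + n)%N = l) (g : d1 + d2 = d) i (t : term E m d1) (u : term E n d2) :
  free_circ h g i (fpi t) (fpi u) = fpi (Tcirc h g i t u).
Proof.
by apply/fpi_eq => P f fE /=; rewrite (frepr_fpi t fE) (frepr_fpi u fE).
Qed.

Lemma free_coll_axioms (K : fieldType) (E : collection K) :
  collection_axioms (@free_act K E).
Proof.
split.
- move=> n d s c; do 2 elim/free_ind=> ?.
  rewrite fpi_lin !free_act_fpi fpi_lin; apply/fpi_eq => P f fE /=.
  by rewrite (coll_act_linear (collP P)).
- move=> n d; elim/free_ind=> x; rewrite free_act_fpi; apply/fpi_eq => P f fE /=.
  by rewrite (coll_act1 (collP P)).
- move=> n d; elim/free_ind=> x s t; rewrite !free_act_fpi; apply/fpi_eq => P f fE /=.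
  by rewrite (coll_actM (collP P)).
Qed.

Definition free_coll (K : fieldType) (E : collection K) : collection K :=
  Collection (free_coll_axioms E).

Lemma free_operad_axioms (K : fieldType) (E : collection K) :
  @operad_axioms K (free_coll E) (fpi Tunit) (@free_circ K E).
Proof.
split=> /=.
- move=> m n l d1 d2 d h g i; elim/free_ind=> b c; do 2 elim/free_ind=> ?.
  rewrite fpi_lin !free_circ_fpi fpi_lin; apply/fpi_eq => P f fE /=.
  by rewrite (op_circ_linearl (operadP P)).
- move=> m n l d1 d2 d h g i; elim/free_ind=> a c; do 2 elim/free_ind=> ?.
  rewrite fpi_lin !free_circ_fpi fpi_lin; apply/fpi_eq => P f fE /=.
  by rewrite (op_circ_linearr (operadP P)).
- move=> n d h g; elim/free_ind=> b; rewrite free_circ_fpi.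
  by apply/fpi_eq => P f fE /=; rewrite (op_unitl (operadP P)).
- move=> m d h g i; elim/free_ind=> a; rewrite free_circ_fpi.
  by apply/fpi_eq => P f fE /=; rewrite (op_unitr (operadP P)).
- move=> m n p l1 l2 l d1 d2 d3 e1 e2 f h1 h2 h3 h4 g1 g2 g3 g4 i j.
  do 3 elim/free_ind=> ?; rewrite !free_circ_fpi; apply/fpi_eq => P F FE /=.
  exact: (op_sequential (operadP P)).
- move=> m n p l1 l2 l d1 d2 d3 e1 e2 f h1 h2 h3 h4 g1 g2 g3 g4 i j.
  do 3 elim/free_ind=> ?; move=> ij; rewrite !free_circ_fpi fpi_scale.
  by apply/fpi_eq => P F FE /=; apply: (op_parallel (operadP P)).
- move=> m n l d1 d2 d h g i; elim/free_ind=> a; elim/free_ind=> b s t.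
  rewrite (free_act_fpi a s) (free_act_fpi b t) !free_circ_fpi free_act_fpi.
  by apply/fpi_eq => P F FE /=; apply: (op_equivariant (operadP P)).
Qed.

Definition free_operad (K : fieldType) (E : collection K) : operad K :=
  Operad (free_operad_axioms E).

Definition eta (K : fieldType) (E : collection K) (n : nat) (d : int)
  (x : E n d) : free_operad E n d := fpi (Tgen x).

Lemma eta_morphism (K : fieldType) (E : collection K) :
  is_coll_morphism (@eta K E).
Proof.
split=> n d.
  move=> c x y; rewrite /eta fpi_lin; apply/fpi_eq => P f [fl fa] /=.
  by rewrite fl.
move=> x s; rewrite /coll_act /= free_act_fpi; apply/fpi_eq => P f [fl fa] /=.
by rewrite fa.
Qed.

Theorem free_operad_universal (K : fieldType) (E : collection K) (P : operad K)
    (f : forall n d, E n d -> P n d) :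
  is_coll_morphism f ->
  exists F : forall n d, free_operad E n d -> P n d,
    [/\ is_operad_morphism F, forall n d (x : E n d), F n d (eta x) = f n d x &
        forall G : forall n d, free_operad E n d -> P n d,
          is_operad_morphism G ->
          (forall n d (x : E n d), G n d (eta x) = f n d x) ->
          forall n d (x : free_operad E n d), G n d x = F n d x].
Proof.
move=> fE; exists (fun n d x => eval f (frepr x)).
have Ff n d (t : term E n d) : eval f (frepr (fpi t)) = eval f t.
  exact: frepr_fpi.
split.
- split; first split.
  + move=> n d c; do 2 elim/free_ind=> ?; rewrite fpi_lin !Ff /=; congr (_ + _).
  + by move=> n d; elim/free_ind=> t s; rewrite /coll_act /= free_act_fpi !Ff.
  + by rewrite Ff.
  + move=> m n l d1 d2 d h g i; do 2 elim/free_ind=> ?.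
    by rewrite /circ /= free_circ_fpi !Ff.
- by move=> n d x; rewrite Ff.
- move=> G [[Gl Ga] Gu Gc] Gf n d; elim/free_ind=> t; rewrite Ff.
  have G0 k e : G k e 0 = 0.
    by have := Gl k e (-1) 0 0; rewrite scaler0 addr0 scaleN1r addNr.
  elim: n d / t => /=.
  + by move=> n d x; apply: Gf.
  + exact: Gu.
  + by move=> n d t <- s; rewrite -Ga /coll_act /= free_act_fpi.
  + move=> m n l d1 d2 d h g i t <- u <-; rewrite -Gc; congr G.
    by rewrite /circ /= free_circ_fpi.
  + by move=> n d; rewrite -[RHS](G0 n d).
  + move=> n d t <- u <-; have := Gl n d 1 (fpi t) (fpi u).
    rewrite fpi_lin !scale1r => <-; congr G.
    by apply/fpi_eq => Q g gE /=; rewrite scale1r.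
  + move=> n d c t <-; have := Gl n d c (fpi t) 0.
    by rewrite G0 !addr0 fpi_scale.
Qed.

Lemma ideal_sub (K : fieldType) (P : operad K) (I : family P) (II : is_ideal I)
    n d (x y : P n d) : I n d x -> I n d y -> I n d (x - y).
Proof.
case: (ideal_subspace II n d) => _ h Ix Iy.
by rewrite addrC -scaleN1r; apply: h.
Qed.

Lemma ideal_scale (K : fieldType) (P : operad K) (I : family P)
    (II : is_ideal I) n d c (x : P n d) : I n d x -> I n d (c *: x).
Proof.
case: (ideal_subspace II n d) => I0 h Ix.
by rewrite -[c *: x]addr0; apply: h.
Qed.

Lemma ideal_add (K : fieldType) (P : operad K) (I : family P) (II : is_ideal I)
    n d (x y : P n d) : I n d x -> I n d y -> I n d (x + y).
Proof.
by case: (ideal_subspace II n d) => _ h Ix Iy; rewrite -[x]scale1r; apply: h.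
Qed.

Lemma ideal_eq (K : fieldType) (P : operad K) (I : family P) (II : is_ideal I)
    n d (x y : P n d) : x = y -> I n d (x - y).
Proof. by move=> ->; rewrite subrr; case: (ideal_subspace II n d). Qed.

Program Definition quo_premod (K : fieldType) (P : operad K) (I : family P)
    (II : is_ideal I) (n : nat) (d : int) : premod K :=
  @Premod K (P n d) (fun x y => I n d (x - y)) 0 +%R *:%R
    _ _ _ _ _ _ _ _ _ _ _ _ _.
Next Obligation. by move=> K P I II n d x /=; apply: (ideal_eq II). Qed.
Next Obligation.
move=> K P I II n d x y /= xy.
by rewrite -opprB -scaleN1r; apply: ideal_scale.
Qed.
Next Obligation.
move=> K P I II n d x y z /= xy yz.
have -> : x - z = (x - y) + (y - z) by rewrite addrA subrK.
exact: ideal_add.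
Qed.
Next Obligation.
move=> K P I II n d x x' y y' /= xx yy.
by rewrite opprD addrACA; apply: ideal_add.
Qed.
Next Obligation.
by move=> K P I II n d c x x' /= xx; rewrite -scalerBr; apply: ideal_scale.
Qed.
Next Obligation. by move=> K P I II n d x y z /=; apply/(ideal_eq II)/addrA. Qed.
Next Obligation. by move=> K P I II n d x y /=; apply/(ideal_eq II)/addrC. Qed.
Next Obligation. by move=> K P I II n d x /=; apply/(ideal_eq II)/add0r. Qed.
Next Obligation.
by move=> K P I II n d x /=; apply/(ideal_eq II); rewrite scaleN1r addNr.
Qed.
Next Obligation. by move=> K P I II n d c c' x /=; apply/(ideal_eq II)/scalerA. Qed.
Next Obligation. by move=> K P I II n d x /=; apply/(ideal_eq II)/scale1r. Qed.
Next Obligation. by move=> K P I II n d c x y /=; apply/(ideal_eq II)/scalerDr. Qed.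
Next Obligation. by move=> K P I II n d x c c' /=; apply/(ideal_eq II)/scalerDl. Qed.

Definition quo_sort (K : fieldType) (P : operad K) (I : family P)
    (II : is_ideal I) (n : nat) (d : int) : lmodType K :=
  quot (quo_premod II n d).

Definition opi (K : fieldType) (P : operad K) (I : family P)
    (II : is_ideal I) (n : nat) (d : int) (x : P n d) : quo_sort II n d :=
  qpi (M := quo_premod II n d) x.

Definition orepr (K : fieldType) (P : operad K) (I : family P)
    (II : is_ideal I) (n : nat) (d : int) (x : quo_sort II n d) : P n d :=
  qrepr (M := quo_premod II n d) x.

Definition quo_act (K : fieldType) (P : operad K) (I : family P)
    (II : is_ideal I) (n : nat) (d : int) (x : quo_sort II n d) (s : 'S_n.+1) :
    quo_sort II n d :=
  opi II (coll_act (orepr x) s).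

Definition quo_circ (K : fieldType) (P : operad K) (I : family P)
    (II : is_ideal I) (m n l : nat) (d1 d2 d : int) (h : (m + n)%N = l)
    (g : d1 + d2 = d) (i : 'I_m.+1) (x : quo_sort II m d1)
    (y : quo_sort II n d2) : quo_sort II l d :=
  opi II (circ h g i (orepr x) (orepr y)).

Lemma opi_eq (K : fieldType) (P : operad K) (I : family P) (II : is_ideal I)
    n d (x y : P n d) : opi II x = opi II y <-> I n d (x - y).
Proof. exact: (@qpi_eq K (quo_premod II n d)). Qed.

Lemma orepr_opi (K : fieldType) (P : operad K) (I : family P) (II : is_ideal I)
    n d (x : P n d) : I n d (orepr (opi II x) - x).
Proof. exact: (@qrepr_qpi K (quo_premod II n d)). Qed.

Lemma oind (K : fieldType) (P : operad K) (I : family P) (II : is_ideal I)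
    n d (S : quo_sort II n d -> Prop) : (forall x, S (opi II x)) -> forall x, S x.
Proof. exact: (@qind K (quo_premod II n d)). Qed.

Lemma opi_linear (K : fieldType) (P : operad K) (I : family P)
    (II : is_ideal I) n d : linear (@opi K P I II n d).
Proof. by move=> c x y; apply/esym/(@qpi_lin K (quo_premod II n d)). Qed.

Lemma opi_scale (K : fieldType) (P : operad K) (I : family P)
    (II : is_ideal I) n d c (x : P n d) : opi II (c *: x) = c *: opi II x.
Proof. by apply/esym/(@qpi_scale K (quo_premod II n d)). Qed.

Lemma linear_sub (K : fieldType) (V W : lmodType K) (f : V -> W) (x y : V) :
  linear f -> f x - f y = f (x - y).
Proof.
by move=> /(_ (-1) y x); rewrite !scaleN1r [- y + x]addrC [- f y + f x]addrC.
Qed.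

Lemma quo_act_opi (K : fieldType) (P : operad K) (I : family P)
    (II : is_ideal I) n d (x : P n d) (s : 'S_n.+1) :
  quo_act (opi II x) s = opi II (coll_act x s).
Proof.
apply/opi_eq.
rewrite (linear_sub _ _ (coll_act_linear (collP P) (n := n) (d := d) s)).
by apply: ideal_act; rewrite //; apply: orepr_opi.
Qed.

Lemma quo_circ_opi (K : fieldType) (P : operad K) (I : family P)
    (II : is_ideal I) m n l d1 d2 d (h : (m + n)%N = l) (g : d1 + d2 = d)
    (i : 'I_m.+1) (x : P m d1) (y : P n d2) :
  quo_circ h g i (opi II x) (opi II y) = opi II (circ h g i x y).
Proof.
apply/opi_eq; set x' := orepr _; set y' := orepr _.
have -> : circ h g i x' y' - circ h g i x y =
    circ h g i (x' - x) y' + circ h g i x (y' - y).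
  rewrite -(linear_sub _ _ (op_circ_linearl (operadP P) h g i y')).
  by rewrite -(linear_sub _ _ (op_circ_linearr (operadP P) h g i x)) addrA subrK.
apply: ideal_add => //.
  by apply: ideal_circl => //; apply: orepr_opi.
by apply: ideal_circr => //; apply: orepr_opi.
Qed.

Lemma quo_coll_axioms (K : fieldType) (P : operad K) (I : family P)
  (II : is_ideal I) : collection_axioms (@quo_act K P I II).
Proof.
split.
- move=> n d s c; elim/oind=> x; elim/oind=> y.
  by rewrite -opi_linear !quo_act_opi (coll_act_linear (collP P)) opi_linear.
- by move=> n d; elim/oind=> x; rewrite quo_act_opi (coll_act1 (collP P)).
- move=> n d; elim/oind=> x s t.
  by rewrite !quo_act_opi (coll_actM (collP P)).
Qed.

Definition quo_coll (K : fieldType) (P : operad K) (I : family P)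
  (II : is_ideal I) : collection K := Collection (quo_coll_axioms II).

Lemma quo_operad_axioms (K : fieldType) (P : operad K) (I : family P)
    (II : is_ideal I) :
  @operad_axioms K (quo_coll II) (opi II (op_unit P)) (@quo_circ K P I II).
Proof.
split.
- move=> m n l d1 d2 d h g i; elim/oind=> b c; elim/oind=> x; elim/oind=> y.
  rewrite -opi_linear !quo_circ_opi (op_circ_linearl (operadP P)).
  exact: opi_linear.
- move=> m n l d1 d2 d h g i; elim/oind=> a c; elim/oind=> x; elim/oind=> y.
  rewrite -opi_linear !quo_circ_opi (op_circ_linearr (operadP P)).
  exact: opi_linear.
- move=> n d h g; elim/oind=> b.
  by rewrite quo_circ_opi (op_unitl (operadP P)).
- move=> m d h g i; elim/oind=> a.
  by rewrite quo_circ_opi (op_unitr (operadP P)).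
- move=> m n p l1 l2 l d1 d2 d3 e1 e2 f h1 h2 h3 h4 g1 g2 g3 g4 i j.
  elim/oind=> a; elim/oind=> b; elim/oind=> c.
  rewrite !quo_circ_opi; congr opi; exact: (op_sequential (operadP P)).
- move=> m n p l1 l2 l d1 d2 d3 e1 e2 f h1 h2 h3 h4 g1 g2 g3 g4 i j.
  elim/oind=> a; elim/oind=> b; elim/oind=> c ij.
  rewrite !quo_circ_opi -[RHS]opi_scale; congr opi.
  exact: (op_parallel (operadP P)).
- move=> m n l d1 d2 d h g i; elim/oind=> a; elim/oind=> b s t.
  change (quo_circ h g i (quo_act (opi II a) s) (quo_act (opi II b) t) =
    quo_act (quo_circ h g (s i) (opi II a) (opi II b)) (circ_perm l i s t)).
  rewrite (quo_act_opi II a s) (quo_act_opi II b t) !quo_circ_opi.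
  rewrite quo_act_opi; congr opi.
  exact: (op_equivariant (operadP P)).
Qed.

Definition quo_operad (K : fieldType) (P : operad K) (I : family P)
  (II : is_ideal I) : operad K := Operad (quo_operad_axioms II).

Definition quo_proj (K : fieldType) (P : operad K) (I : family P)
    (II : is_ideal I) (n : nat) (d : int) (x : P n d) : quo_operad II n d :=
  opi II x.

Lemma quo_proj_morphism (K : fieldType) (P : operad K) (I : family P)
  (II : is_ideal I) : is_operad_morphism (@quo_proj K P I II).
Proof.
split=> //.
- split=> n d; first exact: opi_linear.
  by move=> x s; apply/esym/quo_act_opi.
- by move=> m n l d1 d2 d h g i a b; apply/esym/quo_circ_opi.
Qed.

Lemma quo_proj_surj (K : fieldType) (P : operad K) (I : family P)
    (II : is_ideal I) (n : nat) (d : int) (y : quo_operad II n d) :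
  exists x, quo_proj II x = y.
Proof. by elim/oind: y => x; exists x. Qed.

Lemma quo_proj_ker (K : fieldType) (P : operad K) (I : family P)
    (II : is_ideal I) (n : nat) (d : int) (x : P n d) :
  quo_proj II x = 0 <-> I n d x.
Proof.
have -> : 0 = opi II (0 : P n d) by [].
by split=> [/opi_eq|Ix]; [|apply/opi_eq]; rewrite subr0.
Qed.

Definition presented (K : fieldType) (E : collection K)
    (R : family (free_operad E)) : operad K :=
  quo_operad (ideal_gen_is_ideal R).

Definition presented_gen (K : fieldType) (E : collection K)
    (R : family (free_operad E)) (n : nat) (d : int) (x : E n d) :
    presented R n d :=
  quo_proj (ideal_gen_is_ideal R) (eta x).

Definition mindex (n : nat) : Type := {ffun 'I_n.+1 -> int}.

Definition mi_le (n : nat) (p q : mindex n) : Prop := forall r, p r <= q r.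

Definition mi_min (n : nat) (p q : mindex n) : mindex n :=
  [ffun r => Num.min (p r) (q r)].

Definition mi_const (n : nat) (c : int) : mindex n := [ffun=> c].

Definition mi_perm (n : nat) (p : mindex n) (s : 'S_n.+1) : mindex n :=
  [ffun r => p (s r)].

Definition mi_circ (m n l : nat) (i : 'I_m.+1) (a : mindex m) (b : mindex n) :
    mindex l :=
  [ffun r : 'I_l.+1 =>
     if (r < i)%N then a (inord r)
     else if (r <= i + n)%N then b (inord (r - i)) + a i
     else a (inord (r - n))].

Definition mi_comm (m n l : nat) (i : 'I_m.+1) (j : 'I_n.+1)
    (a : mindex m) (b : mindex n) : mindex l :=
  [ffun r : 'I_l.+1 =>
     if (r < j)%N then b (inord r) + a i
     else if (r < i + j)%N then a (inord (r - j)) + b j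
     else if (r == i + j :> nat)%N then a i + b j - 1
     else if (r <= i + n)%N then b (inord (r - i)) + a i
     else a (inord (r - n)) + b j].

Definition op_comm (K : fieldType) (P : operad K) (m n l : nat) (d1 d2 d : int)
    (h : (m + n)%N = l) (g : d1 + d2 = d) (i : 'I_m.+1) (j : 'I_n.+1)
    (a : P m d1) (b : P n d2) : P l d :=
  coll_act (circ h g i a b) (block_transp l 0 i j) -
  koszul K d1 d2 *:
    coll_act (circ (etrans (addnC n m) h) (etrans (addrC d2 d1) g) j b a)
        (block_transp l (i + j).+1 (m - i) (n - j)).

(* F n p d is the degree d part of F_p P(n + 1) *)
Definition mfamily (K : fieldType) (P : collection K) : Type :=
  forall (n : nat) (p : mindex n) (d : int), P n d -> Prop.

Record is_multifiltration (K : fieldType) (P : operad K) (F : mfamily P) :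
    Prop := IsMultifiltration {
  mf_subspace : forall n p d, is_subspace (F n p d);
  mf_mono : forall n (p q : mindex n) d (x : P n d),
    mi_le p q -> F n p d x -> F n q d x;
  mf_act : forall n (p : mindex n) d (s : 'S_n.+1) (y : P n d),
    F n (mi_perm p s) d y <-> exists2 x, F n p d x & y = coll_act x s;
  mf_circ : forall (m n l : nat) (d1 d2 d : int)
      (h : (m + n)%N = l) (g : d1 + d2 = d)
      (i : 'I_m.+1) (p : mindex m) (q : mindex n) (a : P m d1) (b : P n d2),
    F m p d1 a -> F n q d2 b -> F l (mi_circ l i p q) d (circ h g i a b);
  mf_unit : F 0%N (mi_const 0 0) 0 (op_unit P)
}.

Definition saturated (K : fieldType) (P : operad K) (F : mfamily P) : Prop :=
  forall n (p q : mindex n) d (x : P n d),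
    (F n p d x /\ F n q d x) <-> F n (mi_min p q) d x.

Definition D_condition (K : fieldType) (P : operad K) (F : mfamily P) : Prop :=
  forall (m n l : nat) (d1 d2 d : int) (h : (m + n)%N = l) (g : d1 + d2 = d)
    (i : 'I_m.+1) (j : 'I_n.+1) (p : mindex m) (q : mindex n)
    (a : P m d1) (b : P n d2),
  F m p d1 a -> F n q d2 b -> F l (mi_comm l i j p q) d (op_comm h g i j a b).

Definition is_D_multifiltration (K : fieldType) (P : operad K) (F : mfamily P) :
    Prop :=
  is_multifiltration F /\ D_condition F.

Definition contains_gen (K : fieldType) (E : collection K) (P : operad K)
    (iota : forall n d, E n d -> P n d) (F : mfamily P) : Prop :=
  forall n d (x : E n d), F n (mi_const n 1) d (iota n d x).

(* The smallest saturated D-multifiltration exists as the intersection of all of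
   them, see standard_filtrationP. *)
Definition standard_filtration (K : fieldType) (E : collection K)
    (P : operad K) (iota : forall n d, E n d -> P n d) : mfamily P :=
  fun n p d x => forall F : mfamily P,
    is_D_multifiltration F -> saturated F -> contains_gen iota F -> F n p d x.

Lemma standard_filtrationP (K : fieldType) (E : collection K) (P : operad K)
    (iota : forall n d, E n d -> P n d) :
  [/\ is_D_multifiltration (standard_filtration iota),
      saturated (standard_filtration iota) &
      contains_gen iota (standard_filtration iota)].
Proof.
split; last by move=> n d x F _ _; apply.
- split; first split.
  + move=> n p d; split=> [F FD FS FE|c x y Gx Gy F FD FS FE];
      have [FS0 FSl] := mf_subspace FD.1 p d => //.
    by apply: FSl; [apply: Gx|apply: Gy].
  + by move=> n p q d x pq Gx F FD FS FE; apply: (mf_mono FD.1 pq); apply: Gx.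
  + move=> n p d s y; split=> [Gy|[x Gx ->] F FD FS FE]; last first.
      by apply/(mf_act FD.1); exists x => //; apply: Gx.
    exists (coll_act y s^-1%g); last first.
      by rewrite (coll_actM (collP P)) mulgV (coll_act1 (collP P)).
    move=> F FD FS FE; have /(mf_act FD.1)[x Fx ->] := Gy F FD FS FE.
    by rewrite (coll_actM (collP P)) mulVg (coll_act1 (collP P)).
  + move=> m n l d1 d2 d h g i p q a b Ga Gb F FD FS FE.
    by apply: (mf_circ FD.1); [apply: Ga|apply: Gb].
  + by move=> F FD FS FE; apply: mf_unit FD.1.
  + move=> m n l d1 d2 d h g i j p q a b Ga Gb F FD FS FE.
    by apply: FD.2; [apply: Ga|apply: Gb].
- move=> n p q d x; split=> [[Gp Gq] F FD FS FE|Gx].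
    by apply/FS; split; [apply: Gp|apply: Gq].
  by split=> F FD FS FE; have /FS[] := Gx F FD FS FE.
Qed.

(* P = F(E)/(R), compatibly with the given map iota : E -> P: the morphism
   F(E) -> P extending iota is onto with kernel the ideal (R). *)
Definition presentation (K : fieldType) (E : collection K) (P : operad K)
    (iota : forall n d, E n d -> P n d) (R : family (free_operad E)) : Prop :=
  (forall n d, is_subspace (R n d)) /\
  exists phi : forall n d, free_operad E n d -> P n d,
    [/\ is_operad_morphism phi,
        forall n d (x : E n d), phi n d (eta x) = iota n d x,
        forall n d (y : P n d), exists x, phi n d x = y &
        forall n d (x : free_operad E n d), phi n d x = 0 <-> ideal_gen R x].

Definition tight_relations (K : fieldType) (E : collection K)
    (R : family (free_operad E)) : Prop :=
  forall n d (x : free_operad E n d),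
    R n d x -> standard_filtration (@eta K E) (mi_const n 1) x.

Definition quadratic_part (K : fieldType) (E : collection K) :
    family (free_operad E) :=
  fun l d => span (fun x => exists (m n : nat) (d1 d2 : int) (h : (m + n)%N = l)
      (g : d1 + d2 = d) (i : 'I_m.+1) (a : E m d1) (b : E n d2) (s : 'S_l.+1),
    x = coll_act (circ h g i (eta a) (eta b)) s).

Definition tight (K : fieldType) (E : collection K) (P : operad K)
    (iota : forall n d, E n d -> P n d) : Prop :=
  exists R : family (free_operad E), presentation iota R /\ tight_relations R.

Definition tight_quadratic (K : fieldType) (E : collection K) (P : operad K)
    (iota : forall n d, E n d -> P n d) : Prop :=
  exists R : family (free_operad E),
    [/\ presentation iota R, tight_relations R &
        subfamily R (quadratic_part (E := E))].

(* Index n is arity k = n + 1, so the degree k - 2 is n - 1; the row vectors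
   have length 1 in that degree and length 0 otherwise. *)
Definition Linf_gen_sort (K : fieldType) (n : nat) (d : int) : lmodType K :=
  'rV[K]_(d == n%:Z - 1).

Definition Linf_gen_act (K : fieldType) (n : nat) (d : int)
    (x : Linf_gen_sort K n d) (s : 'S_n.+1) : Linf_gen_sort K n d :=
  (-1) ^+ s *: x.

Lemma Linf_gen_axioms (K : fieldType) : collection_axioms (@Linf_gen_act K).
Proof.
split=> n d; rewrite /Linf_gen_act.
- by move=> s c x y; rewrite scalerDr !scalerA mulrC.
- by move=> x; rewrite odd_perm1 expr0 scale1r.
- by move=> x s t; rewrite scalerA -signr_addb odd_permM.
Qed.

Definition Linf_gen (K : fieldType) : collection K :=
  Collection (Linf_gen_axioms K).

Definition ell (K : fieldType) (n : nat) : Linf_gen K n (n%:Z - 1) :=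
  const_mx 1.

Definition ell_free (K : fieldType) (n : nat) :
  free_operad (Linf_gen K) n (n%:Z - 1) := eta (ell K n).

Definition is_shuffle (k i : nat) (s : 'S_k) : bool :=
  [forall r : 'I_k, forall t : 'I_k,
     (r < t)%N && ((t < i)%N || (i <= r)%N) ==> (s r < s t)%N].

Lemma jac_arity (n : nat) (a : 'I_n.+1) : (n - a + a)%N = n.
Proof. by rewrite subnK // -ltnS. Qed.

Lemma jac_degree (n : nat) (a : 'I_n.+1) (d : int) :
  n%:Z - 2 = d -> ((n - a)%N%:Z - 1) + (a%:Z - 1) = d.
Proof. by have := ltn_ord a; lia. Qed.

(* The Jacobi identity in arity k = n + 1, of degree k - 3 = n - 2, with
   i = a + 1 and j = n - a + 1.  Since f.s inserts the input x_r in position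
   s(r), inserting x_{s(r)} in position r is the action of s^-1. *)
Definition jac (K : fieldType) (n : nat) (d : int) (g : n%:Z - 2 = d) :
    free_operad (Linf_gen K) n d :=
  \sum_(a < n.+1) \sum_(s : 'S_n.+1 | is_shuffle a.+1 s)
    ((-1) ^+ s * (-1) ^+ (a.+1 * (n - a))) *:
      coll_act (circ (jac_arity a) (jac_degree a g) ord0
             (ell_free K (n - a)) (ell_free K a)) s^-1%g.

Definition Linf_rel (K : fieldType) : family (free_operad (Linf_gen K)) :=
  fun n d => span (fun x => exists g : n%:Z - 2 = d, x = jac K g).

Definition Linf (K : fieldType) : operad K := presented (@Linf_rel K).

Definition Linf_iota (K : fieldType) (n : nat) (d : int)
    (x : Linf_gen K n d) : Linf K n d :=
  presented_gen (@Linf_rel K) x.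

(* Main.v *)
(* By saturation it is enough to show, for every input r, that the Jacobiator
   lies in filtration (2,...,2,1,2,...,2) with the 1 at position r.  Its summands
   l_j(l_i(x_S), x_(S^c)) depend only on the set S of inputs of the inner
   operation, by antisymmetry of the generators, and have filtration 2 on S and
   1 on S^c; so those with r not in S are fine.  The summands with r in S are
   paired by the involution S |-> {r} u S^c, and the sum of such a pair is, up to
   sign, a commutator of two generators in which the shared slot is the input r.
   The involution may have a fixed point (when S is everything and n = 0), so one
   sums the pairs over all S and divides by 2. *)

Require Import Defs.
From mathcomp Require Import all_boot all_order all_algebra all_fingroup.
From mathcomp Require Import boolp zify.

Set Implicit Arguments.
Unset Strict Implicit.
Unset Printing Implicit Defensive.

Import Order.TTheory GRing.Theory Num.Theory.
Local Open Scope ring_scope.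

(** * Shuffles, the sets of inner inputs, and the parity of block transpositions *)

Definition initial_seg (n a : nat) : {set 'I_n.+1} := [set x : 'I_n.+1 | (x <= a)%N].

(** The action of [s^-1] puts the input x_(s(r)) into slot r, and slots 0, ..., a belong to the
    inner generator, so this is the set S of the overview. *)
Definition inner_set (n a : nat) (s : 'S_n.+1) : {set 'I_n.+1} :=
  s @: initial_seg n a.

Lemma card_initial_seg (n a : nat) : (a <= n)%N -> #|initial_seg n a| = a.+1.
Proof.
move=> an; rewrite -sum1_card (eq_bigl (fun i : 'I_n.+1 => (i < a.+1)%N)).
  by rewrite -(@big_ord_widen _ _ _ a.+1 n.+1 (fun=> 1%N)) // sum1_card card_ord.
by move=> i; rewrite inE ltnS.
Qed.

Lemma card_inner_set (n a : nat) (s : 'S_n.+1) :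
  (a <= n)%N -> #|inner_set a s| = a.+1.
Proof. by move=> an; rewrite card_imset ?card_initial_seg //; apply: perm_inj. Qed.

Lemma mem_inner_set (n a : nat) (s : 'S_n.+1) (x : 'I_n.+1) :
  (x \in inner_set a s) = (s^-1%g x <= a)%N.
Proof.
by rewrite -{1}(permKV s x) /inner_set mem_imset ?inE //; apply: perm_inj.
Qed.

Lemma sorted_enum_ord (n : nat) (A : {pred 'I_n}) :
  sorted (fun x y : 'I_n => (x < y)%N) (enum A).
Proof.
rewrite {1}/enum_mem; apply: sorted_filter => [x y z|]; first exact: ltn_trans.
by rewrite -(@sorted_map _ _ (@nat_of_ord n) ltn) -enumT val_enum_ord iota_ltn_sorted.
Qed.

(** Both lists are strictly increasing with the same elements, hence equal. *)
Lemma map_enum_incr (n : nat) (f : 'I_n -> 'I_n) (A B : {set 'I_n}) :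
  {in A &, {homo f : x y / (x < y)%N}} -> f @: A = B -> map f (enum A) = enum B.
Proof.
move=> fA fAB; apply: (irr_sorted_eq (leT := fun x y : 'I_n => (x < y)%N)).
- by move=> x y z; apply: ltn_trans.
- by move=> x; apply: ltnn.
- apply: (homo_sorted_in fA _ (sorted_enum_ord A)).
  by apply/allP => x; rewrite mem_enum.
- exact: sorted_enum_ord.
by move=> x; rewrite mem_enum -fAB; apply/mapP/imsetP => -[y yA ->]; exists y;
  rewrite ?mem_enum // in yA *.
Qed.

Lemma setC_inner_set (n a : nat) (s : 'S_n.+1) :
  s @: (~: initial_seg n a) = ~: inner_set a s.
Proof.
apply/setP => x; rewrite -[x](permKV s) mem_imset ?inE; last exact: perm_inj.
by rewrite mem_inner_set permK.
Qed.

Lemma shuffle_homo (n a : nat) (s : 'S_n.+1) (x y : 'I_n.+1) :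
  is_shuffle a.+1 s -> ((x <= a) = (y <= a))%N -> (x < y)%N -> (s x < s y)%N.
Proof.
move=> /forallP/(_ x)/forallP/(_ y)/implyP sxy xya xy; apply: sxy.
by rewrite xy /=; lia.
Qed.

(** A shuffle is increasing on [initial_seg n a] and on its complement, so it is determined by the
    images of these two blocks, which are S and the complement of S. *)
Lemma shuffle_inj (n a : nat) (s t : 'S_n.+1) :
  is_shuffle a.+1 s -> is_shuffle a.+1 t ->
  inner_set a s = inner_set a t -> s = t.
Proof.
move=> ss ts st; apply/permP => x.
have mapE (u : 'S_n.+1) (A : {set 'I_n.+1}) : is_shuffle a.+1 u ->
    A = initial_seg n a \/ A = ~: initial_seg n a ->
    map u (enum A) = enum (u @: A).
  move=> us AE; apply: map_enum_incr => // y z yA zA.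
  apply: shuffle_homo us _.
  by case: AE yA zA => ->; rewrite !inE; lia.
suff [A xA [Ai stA]] : exists2 A : {set 'I_n.+1}, x \in A &
    (A = initial_seg n a \/ A = ~: initial_seg n a) /\ s @: A = t @: A.
  have := mapE s A ss Ai; rewrite stA -(mapE t A ts Ai) => /eq_in_map; apply.
  by rewrite mem_enum.
case xa: (x \in initial_seg n a); first by exists (initial_seg n a); auto.
exists (~: initial_seg n a); first by rewrite inE xa.
by split; [right|rewrite !setC_inner_set st].
Qed.

(** The shuffle lists S in increasing order, followed by the complement of S in increasing order. *)
Lemma shuffle_exists (n a : nat) (S : {set 'I_n.+1}) :
  #|S| = a.+1 -> exists2 s : 'S_n.+1, is_shuffle a.+1 s & inner_set a s = S.
Proof.
move=> Sa; pose L := enum S ++ enum (~: S).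
have sL : size L = n.+1.
  by rewrite size_cat -!cardE cardsC card_ord.
have uL : uniq L.
  rewrite cat_uniq !enum_uniq andbT /=; apply/hasPn => x.
  by rewrite !mem_enum inE.
have finj : injective (fun x : 'I_n.+1 => nth ord0 L x).
  move=> x y /eqP; rewrite nth_uniq ?sL ?ltn_ord // => /eqP xy.
  exact: val_inj.
have sE (x : 'I_n.+1) : perm finj x =
    if (x <= a)%N then nth ord0 (enum S) x else nth ord0 (enum (~: S)) (x - a.+1).
  by rewrite permE nth_cat -cardE Sa ltnS.
have nthS (A : {set 'I_n.+1}) (i j : nat) : (i < j < #|A|)%N ->
    (nth ord0 (enum A) i < nth ord0 (enum A) j)%N.
  move=> /andP[ij jA]; have tr : transitive (fun x y : 'I_n.+1 => (x < y)%N).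
    by move=> x y z; apply: ltn_trans.
  apply: (sorted_ltn_nth tr ord0 (sorted_enum_ord A)); rewrite ?inE -?cardE //.
  exact: ltn_trans jA.
have Sc : #|~: S| = (n - a)%N by have := cardsC S; rewrite card_ord Sa; lia.
have an : (a <= n)%N by have := max_card (mem S); rewrite card_ord Sa ltnS.
exists (perm finj).
  apply/forallP => x; apply/forallP => y; apply/implyP => xy; rewrite !sE.
  have := ltn_ord y; have := ltn_ord x.
  case: (leqP x a) => xa; case: (leqP y a) => ya; try lia.
    by move=> *; apply: nthS; rewrite Sa; lia.
  by move=> *; apply: nthS; rewrite Sc; lia.
apply/eqP; rewrite eqEcard card_inner_set // Sa leqnn andbT.
apply/subsetP => x /imsetP[y]; rewrite inE => ya ->; rewrite sE ya -mem_enum.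
by rewrite mem_nth // -cardE Sa.
Qed.

(* The block transposition fixes 0 and rotates the other n inputs by a steps. *)
Lemma odd_block_transp (n a b : nat) :
  (a + b)%N = n -> block_transp n 1 b a = odd (a * b) :> bool.
Proof.
case: n => [|n] abn.
  have -> : block_transp 0 1 b a = 1%g by apply/permP => x; rewrite !ord1.
  by rewrite odd_perm1; have -> : a = 0%N by lia.
(* [rho] fixes 0 and cycles 1, ..., n + 1 down by one, sending 1 to n + 1. The block transposition
   is its a-th power. *)
pose rho : 'S_n.+2 := lift_perm (inord 1) ord_max 1%g.
have rhoE (k : 'I_n.+2) : rho k =
    (if k == 0 :> nat then 0 else if k == 1 :> nat then n.+1 else k.-1)%N :> nat.
  have [->|] := eqVneq k (inord 1); first by rewrite lift_perm_id inordK.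
  rewrite eq_sym => /unlift_some[k' -> _].
  rewrite lift_perm_lift perm1 /= !/bump inordK //.
  by case: k' => -[|k'] kn //=; rewrite ltnNge -ltnS kn.
have iterE (c : nat) (k : 'I_n.+2) : (c <= n.+1)%N -> (rho ^+ c)%g k =
    (if k == 0 :> nat then 0 else if k <= c then k + (n.+1 - c) else k - c)%N :> nat.
  elim: c => [|c IH] cn; first by rewrite expg0 perm1; do ?case: ifP; lia.
  by rewrite expgSr permM rhoE (IH (ltnW cn)); have := ltn_ord k; do ?case: ifP; lia.
have -> : block_transp n.+1 1 b a = (rho ^+ a)%g.
  apply/permP => k; apply: ord_inj; rewrite block_transpE ?iterE; try lia.
  by rewrite /block_transp_nat; have := ltn_ord k; do ?case: ifP; lia.
have -> : odd_perm (rho ^+ a)%g = odd a && odd_perm rho.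
  elim: (a) => [|c IH]; first by rewrite expg0 odd_perm1.
  by rewrite expgSr odd_permM IH /=; case: odd; case: odd_perm.
(* As a cycle of length n + 1, [rho] has the parity of n; when a is odd, a + b = n + 1 gives n the
   parity of b. *)
rewrite odd_lift_perm odd_perm1 inordK //= addbF oddM; lia.
Qed.

(** * Linear maps and subspaces *)

Lemma linear_scale (K : fieldType) (V W : lmodType K) (f : V -> W) (c : K) (x : V) :
  linear f -> f (c *: x) = c *: f x.
Proof. by move=> /GRing.scalable_linear; apply. Qed.

Lemma linear_add (K : fieldType) (V W : lmodType K) (f : V -> W) (x y : V) :
  linear f -> f (x + y) = f x + f y.
Proof. by move=> fl; have := fl 1 x y; rewrite !scale1r. Qed.

Lemma subspace_scale (K : fieldType) (V : lmodType K) (S : V -> Prop) c x :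
  is_subspace S -> S x -> S (c *: x).
Proof. by case=> S0 Sl Sx; rewrite -[_ *: _]addr0; apply: Sl. Qed.

Lemma subspace_sum (K : fieldType) (V : lmodType K) (S : V -> Prop)
    (I : finType) (P : pred I) (f : I -> V) :
  is_subspace S -> (forall i, P i -> S (f i)) -> S (\sum_(i | P i) f i).
Proof.
case=> S0 Sl Sf; elim/big_ind: _ => // x y Sx Sy.
by rewrite -[x]scale1r; apply: Sl.
Qed.

(** * Antisymmetry of composites of two generators *)

Lemma ell_free_act (K : fieldType) (n : nat) (s : 'S_n.+1) :
  coll_act (ell_free K n) s = (-1) ^+ s *: ell_free K n.
Proof.
have [etal etaa] := eta_morphism (Linf_gen K).
by rewrite /ell_free -etaa -(linear_scale _ _ (etal _ _)).
Qed.

Lemma koszul_odd (K : fieldType) (d e : int) :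
  koszul K d e = (-1) ^+ (odd `|d| && odd `|e|).
Proof.
rewrite /koszul -oddM -abszM signr_odd.
by case: (d * e) => n //; rewrite /exprz /= invr_sign.
Qed.

Definition ell_comp (K : fieldType) (a b n : nat) (d : int) (h : (b + a)%N = n)
    (g : (b%:Z - 1) + (a%:Z - 1) = d) : free_operad (Linf_gen K) n d :=
  circ h g ord0 (ell_free K b) (ell_free K a).

(** By equivariance, a transposition of two inputs of the same generator moves onto that generator,
    where it acts by -1. *)
Lemma ell_comp_tperm (K : fieldType) (a b n : nat) (d : int) (h : (b + a)%N = n)
    (g : (b%:Z - 1) + (a%:Z - 1) = d) (x y : 'I_n.+1) :
  x != y -> ((x <= a) = (y <= a))%N ->
  coll_act (ell_comp K h g) (tperm x y) = - ell_comp K h g.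
Proof.
move=> xy xya; have P := operadP (free_operad (Linf_gen K)).
have xn := ltn_ord x; have yn := ltn_ord y.
case: (leqP x a) xya => xa /esym ya.
- pose t : 'S_a.+1 := tperm (inord x) (inord y).
  have tE : tperm x y = circ_perm n (ord0 : 'I_b.+1) 1%g t.
    apply/permP => r; apply: ord_inj; have rn := ltn_ord r.
    rewrite circ_permE // /circ_perm_nat /outer_slot !perm1 /= subn0.
    case: tpermP => [->|->|/eqP rx /eqP ry].
    - by rewrite xa tpermL inordK.
    - by rewrite ya tpermR inordK.
    case: leqP => ra; last by rewrite inordK; lia.
    rewrite -val_eqE /= in rx; rewrite -val_eqE /= in ry.
    by rewrite tpermD ?inordK -?val_eqE /= ?inordK; lia.
  have := op_equivariant P h g ord0 (ell_free K b) (ell_free K a) 1%g t.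
  rewrite -tE (coll_act1 (collP _)) perm1 -/(ell_comp K h g) => <-.
  rewrite ell_free_act (linear_scale _ _ (op_circ_linearr P h g ord0 _)).
  rewrite odd_tperm (_ : inord x != inord y); first by rewrite expr1 scaleN1r.
  by rewrite -val_eqE /= !inordK ?ltnS.
(* An input x > a of the composite is slot x - a of the outer generator; [t] fixes slot 0, so the
   composition still takes place there. *)
- pose t : 'S_b.+1 := tperm (inord (x - a)) (inord (y - a)).
  have t0 : t ord0 = ord0.
    by rewrite tpermD // -val_eqE /= inordK; lia.
  have tE : tperm x y = circ_perm n (ord0 : 'I_b.+1) t (1%g : 'S_a.+1).
    apply/permP => r; apply: ord_inj; have rn := ltn_ord r.
    rewrite circ_permE // /circ_perm_nat /outer_slot t0 !perm1 /= subn0 add0n.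
    case: tpermP => [->|->|/eqP rx /eqP ry].
    - by rewrite leqNgt xa /= tpermL inordK; lia.
    - by rewrite ya tpermR inordK; lia.
    case: leqP => ra; first by rewrite inordK.
    rewrite -val_eqE /= in rx; rewrite -val_eqE /= in ry.
    by rewrite tpermD ?inordK -?val_eqE /= ?inordK; lia.
  have := op_equivariant P h g ord0 (ell_free K b) (ell_free K a) t 1%g.
  rewrite -tE (coll_act1 (collP _)) t0 -/(ell_comp K h g) => <-.
  rewrite ell_free_act (linear_scale _ _ (op_circ_linearl P h g ord0 _)).
  rewrite odd_tperm (_ : inord _ != inord _); first by rewrite expr1 scaleN1r.
  by rewrite -val_eqE /= in xy; rewrite -val_eqE /= !inordK; lia.
Qed.

(** Induction on the number of moved points: a block-preserving permutation is a product of
    transpositions within the blocks. *)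
Lemma ell_comp_act (K : fieldType) (a b n : nat) (d : int) (h : (b + a)%N = n)
    (g : (b%:Z - 1) + (a%:Z - 1) = d) (t : 'S_n.+1) :
  (forall x, (t x <= a) = (x <= a))%N ->
  coll_act (ell_comp K h g) t = (-1) ^+ t *: ell_comp K h g.
Proof.
have P := collP (free_operad (Linf_gen K)).
have [k] := ubnP #|[set x | t x != x]|; elim: k t => // k IH t tk ta.
have [t1|[x tx]] : t = 1%g \/ exists x, t x != x.
  case: (pickP (fun x => t x != x)) => [x tx|t1]; [by right; exists x|left].
  by apply/permP => x; rewrite perm1; apply/eqP/negbFE/t1.
  by rewrite t1 (coll_act1 P) odd_perm1 scale1r.
(* [u] fixes x in addition to all fixed points of [t], and preserves the blocks because x and [t x]
   lie in the same one. *)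
pose u := (t * tperm x (t x))%g.
have uE : coll_act (ell_comp K h g) u = (-1) ^+ u *: ell_comp K h g.
  apply: IH.
    rewrite -ltnS; apply: leq_trans tk; rewrite ltnS.
    apply: proper_card; apply/properP; split.
      apply/subsetP => y; rewrite !inE permM; apply: contraNneq => ty.
      rewrite ty tpermD //.
        by apply: contraNneq tx => ->; rewrite ty.
      by apply: contraNneq tx => xy; rewrite -xy in ty; apply/eqP/(perm_inj ty).
    by exists x; rewrite !inE ?tx // permM tpermR eqxx.
  move=> y; rewrite permM; case: tpermP => [ty|ty|_ _]; last exact: ta.
    by rewrite -(ta y) ty ta.
  by rewrite -(ta y) ty ta.
have oE : odd_perm u = ~~ odd_perm t by rewrite odd_permM odd_tperm eq_sym tx addbT.
apply: oppr_inj; rewrite -scaleNr.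
have -> : - (-1) ^+ t = (-1) ^+ u :> K.
  by rewrite oE; case: (odd_perm t); rewrite ?expr0 ?expr1 ?opprK.
rewrite -uE /u -(coll_actM P) ell_comp_tperm ?ta //; last by rewrite eq_sym.
by rewrite -[- ell_comp K h g]scaleN1r (linear_scale _ _ (coll_act_linear P t)) scaleN1r.
Qed.

(** Two permutations with the same inner set differ by one preserving the blocks, whose sign
    cancels. This makes a signed Jacobi summand a function of S alone. *)
Lemma ell_comp_inner_set (K : fieldType) (a b n : nat) (d : int) (h : (b + a)%N = n)
    (g : (b%:Z - 1) + (a%:Z - 1) = d) (s t : 'S_n.+1) :
  inner_set a s = inner_set a t ->
  (-1) ^+ s *: coll_act (ell_comp K h g) s^-1%g =
  (-1) ^+ t *: coll_act (ell_comp K h g) t^-1%g.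
Proof.
have P := collP (free_operad (Linf_gen K)).
move=> st; have -> : s^-1%g = (t^-1 * (t * s^-1))%g by rewrite mulgA mulVg mul1g.
rewrite -(coll_actM P) ell_comp_act => [|x]; last first.
  by rewrite permM -mem_inner_set st mem_inner_set permK.
rewrite (linear_scale _ _ (coll_act_linear P _)) scalerA odd_permM odd_permV.
by rewrite signr_addb mulrCA -signr_addb addbb mulr1.
Qed.

(** * Filtration of composites and of commutators *)

Definition spiked (n : nat) (r : 'I_n.+1) : mindex n :=
  [ffun x => if x == r then 1 else 2].

Lemma mi_perm_spiked (n : nat) (s : 'S_n.+1) (r : 'I_n.+1) :
  mi_perm (spiked r) s^-1%g = spiked (s r).
Proof.
apply/ffunP => x; rewrite !ffunE.
by rewrite -(inj_eq (@perm_inj _ s)) permKV.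
Qed.

Lemma ell_comp_filtration (K : fieldType) (F : mfamily (free_operad (Linf_gen K)))
    (FD : is_D_multifiltration F) (FE : contains_gen (@eta K (Linf_gen K)) F)
    (a b n : nat) (d : int) (h : (b + a)%N = n)
    (g : (b%:Z - 1) + (a%:Z - 1) = d) (s : 'S_n.+1) (r : 'I_n.+1) :
  r \notin inner_set a s ->
  F _ (spiked r) _ (coll_act (ell_comp K h g) s^-1%g).
Proof.
(* The entries of [p] are 1 + 1 = 2 on the inner slots and 1 on the outer ones. After permuting, the
   entry at r is 1, and monotonicity raises the other 1s to 2. *)
move=> rs; pose p : mindex n := mi_circ n ord0 (mi_const b 1) (mi_const a 1).
apply: (mf_mono (p := mi_perm p s^-1%g) FD.1).
  move=> x; rewrite !ffunE /=; case: eqP => [->|_]; last by case: ifP.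
  by rewrite -mem_inner_set (negbTE rs).
apply/(mf_act FD.1); exists (ell_comp K h g) => //.
by apply: (mf_circ FD.1); apply: FE.
Qed.

(** The two summands together are a signed commutator of [ell_free K b] and [ell_free K a] at slots
    0 and 0, permuted by [s^-1] so that the shared slot receives the input [s ord0]. *)
Lemma ell_comp_swap (K : fieldType) (F : mfamily (free_operad (Linf_gen K)))
    (FD : is_D_multifiltration F) (FE : contains_gen (@eta K (Linf_gen K)) F)
    (a b n : nat) (d : int)
    (h : (b + a)%N = n) (g : (b%:Z - 1) + (a%:Z - 1) = d)
    (h' : (a + b)%N = n) (g' : (a%:Z - 1) + (b%:Z - 1) = d) (s t : 'S_n.+1) :
  inner_set b t = s ord0 |: ~: inner_set a s ->
  F _ (spiked (s ord0)) _
    (((-1) ^+ s * (-1) ^+ (a.+1 * b)) *: coll_act (ell_comp K h g) s^-1%g +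
     ((-1) ^+ t * (-1) ^+ (b.+1 * a)) *: coll_act (ell_comp K h' g') t^-1%g).
Proof.
have P := collP (free_operad (Linf_gen K)).
(* [u] keeps the shared slot 0 and exchanges the remaining inputs of the two generators, so [t] may
   be replaced by [u^-1 * s]. *)
move=> st; pose u : 'S_n.+1 := block_transp n 1 b a.
have tE : inner_set b t = inner_set b (u^-1 * s)%g.
  rewrite st; apply/setP => x; rewrite !inE !mem_inner_set invMg invgK permM.
  rewrite -(inj_eq (@perm_inj _ s^-1%g)) permK -val_eqE /=.
  rewrite block_transpE; last by lia.
  have := ltn_ord (s^-1%g x); move: (nat_of_ord (s^-1%g x)) => y.
  rewrite /block_transp_nat; by do ?case: ifP => ?; lia.
have ou : odd_perm u = odd (a * b) by apply: odd_block_transp.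
have -> : ((-1) ^+ t * (-1) ^+ (b.+1 * a)) *: coll_act (ell_comp K h' g') t^-1%g =
   ((-1) ^+ s * (-1) ^+ a) *: coll_act (coll_act (ell_comp K h' g') u) s^-1%g.
  rewrite [_ ^+ t * _]mulrC -[LHS]scalerA (ell_comp_inner_set _ h' g' tE).
  rewrite scalerA invMg invgK.
  rewrite (coll_actM P) odd_permM odd_permV ou signr_addb; congr (_ *: _).
  rewrite mulrA mulrC; congr (_ * _); rewrite signr_odd -exprD -signr_odd.
  by rewrite -[RHS]signr_odd; congr (_ ^+ nat_of_bool _); lia.
have Fc : F _ (spiked (ord0 : 'I_n.+1)) _
    (op_comm h g ord0 ord0 (ell_free K b) (ell_free K a)).
  (* The commutator index is 1 + 1 - 1 = 1 at the shared slot and 1 + 1 = 2 elsewhere. *)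
  have -> : spiked ord0 = mi_comm n ord0 ord0 (mi_const b 1) (mi_const a 1).
    by apply/ffunP => x; rewrite !ffunE -val_eqE; do ?case: ifP.
  by apply: FD.2; apply: FE.
have {}Fc : F _ (spiked (s ord0)) _ (coll_act
    (op_comm h g ord0 ord0 (ell_free K b) (ell_free K a)) s^-1%g).
  by rewrite -mi_perm_spiked; apply/(mf_act FD.1); eexists; first exact: Fc.
have := subspace_scale ((-1) ^+ s * (-1) ^+ (a.+1 * b)) (mf_subspace FD.1 _ d) Fc.
set x := _ *: _; set y := _ + _; suff -> : x = y by []; rewrite {}/x {}/y.
rewrite /op_comm -/(ell_comp K h g) addnn double0 !subn0 -/u.
have -> : block_transp n 0 (ord0 : 'I_b.+1) (ord0 : 'I_a.+1) = 1%g.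
  apply/permP => x; apply: ord_inj; rewrite block_transpE // perm1.
  by rewrite /block_transp_nat; do ?case: ifP.
rewrite (coll_act1 P) (_ : circ _ _ _ _ _ = ell_comp K h' g'); last first.
  by rewrite /ell_comp; congr circ; apply: Prop_irrelevance.
rewrite -scaleNr (linear_add _ _ (coll_act_linear P _)).
rewrite (linear_scale _ _ (coll_act_linear P _)) scalerDr scalerA; congr (_ + _ *: _).
(* The degrees are b - 1 and a - 1, and (a + 1)b + 1 + (a - 1)(b - 1) has the parity of a. *)
rewrite -mulrA; congr (_ * _); rewrite koszul_odd.
rewrite -[X in X * _]signr_odd -[RHS]signr_odd oddM /=.
have oddB (c : nat) : odd `|c%:Z - 1| = ~~ odd c by case: c => [|c]; lia.
by rewrite !oddB; case: (odd a); case: (odd b);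
  rewrite /= ?expr0 ?expr1 ?mulrN ?mulN1r ?mul1r ?opprK.
Qed.

(** * The Jacobiator as a sum over sets of inner inputs *)

Definition jac_term (K : fieldType) (n : nat) (d : int) (g : n%:Z - 2 = d)
    (a : 'I_n.+1) (s : 'S_n.+1) : free_operad (Linf_gen K) n d :=
  ((-1) ^+ s * (-1) ^+ (a.+1 * (n - a))) *:
    coll_act (ell_comp K (jac_arity a) (jac_degree a g)) s^-1%g.

(** Frees the outer index from the form n - a, so that a and b can play symmetric roles in a
    pair. *)
Lemma jac_termE (K : fieldType) (n : nat) (d : int) (g : n%:Z - 2 = d)
    (a : 'I_n.+1) (b : nat) (h : (b + a)%N = n)
    (g' : (b%:Z - 1) + (a%:Z - 1) = d) (s : 'S_n.+1) :
  jac_term K g a s =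
  ((-1) ^+ s * (-1) ^+ (a.+1 * b)) *: coll_act (ell_comp K h g') s^-1%g.
Proof.
have bE : b = (n - a)%N by lia.
rewrite /jac_term; subst b.
by rewrite (Prop_irrelevance h (jac_arity a)) (Prop_irrelevance g' (jac_degree a g)).
Qed.

(** The sum has one term for nonempty S and none for empty S; written as a sum, it is total in S and
    requires no choice of shuffle. *)
Definition jac_block (K : fieldType) (n : nat) (d : int) (g : n%:Z - 2 = d)
    (S : {set 'I_n.+1}) : free_operad (Linf_gen K) n d :=
  \sum_(p : 'I_n.+1 * 'S_n.+1 |
      is_shuffle p.1.+1 p.2 && (inner_set p.1 p.2 == S)) jac_term K g p.1 p.2.

(** Here [s] need not be a shuffle: by antisymmetry its term equals that of the unique shuffle with
    the same inner set. *)
Lemma jac_blockE (K : fieldType) (n : nat) (d : int) (g : n%:Z - 2 = d)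
    (a : 'I_n.+1) (s : 'S_n.+1) :
  jac_block K g (inner_set a s) = jac_term K g a s.
Proof.
have cardE (b : 'I_n.+1) (t : 'S_n.+1) : #|inner_set b t| = b.+1.
  by rewrite card_inner_set // -ltnS.
have [t tsh ts] := shuffle_exists (cardE a s).
rewrite /jac_block (big_pred1 (a, t)) => [|[b u] /=].
  rewrite /jac_term !(mulrC _ ((-1) ^+ (a.+1 * (n - a)))) -!scalerA; congr (_ *: _).
  exact: ell_comp_inner_set.
apply/andP/eqP => [[ush /eqP us]|[-> ->]]; last by rewrite ts.
have ba : b = a.
  by apply: ord_inj; apply: succn_inj; rewrite -(cardE b u) us cardE.
rewrite ba in ush us *; congr (_, _).
by apply: (shuffle_inj ush tsh); rewrite us ts.
Qed.

Lemma jac_sum_block (K : fieldType) (n : nat) (d : int) (g : n%:Z - 2 = d) :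
  jac K g = \sum_(S : {set 'I_n.+1} | S != set0) jac_block K g S.
Proof.
rewrite /jac pair_big_dep /=.
rewrite (partition_big (fun p : 'I_n.+1 * 'S_n.+1 => inner_set p.1 p.2)
  (fun S => S != set0)) //= => -[a s] _ /=.
by rewrite -card_gt0 card_inner_set // -ltnS.
Qed.

(** Precomposing a shuffle with a transposition inside the first block keeps S and brings r to slot
    0, the slot shared in the commutator. *)
Lemma set_inner_set (n : nat) (S : {set 'I_n.+1}) (r : 'I_n.+1) :
  r \in S -> exists a : 'I_n.+1, exists2 s : 'S_n.+1,
    s ord0 = r & inner_set a s = S.
Proof.
move=> rS; have S0 : (0 < #|S|)%N by apply/card_gt0P; exists r.
have Sn : (#|S| <= n.+1)%N by have := max_card (mem S); rewrite card_ord.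
have an : (#|S|.-1 < n.+1)%N by rewrite prednK.
pose a := Ordinal an; have Sa : #|S| = a.+1 by rewrite /= prednK.
have [t _ tS] := shuffle_exists Sa.
have ra : (t^-1%g r <= a)%N by rewrite -mem_inner_set tS.
exists a; exists (tperm ord0 (t^-1%g r) * t)%g; first by rewrite permM tpermL permKV.
rewrite -tS; apply/setP => x; rewrite !mem_inner_set invMg permM tpermV.
by case: tpermP => [->|->|//]; rewrite ra.
Qed.

(** * Filtration of the Jacobiator, tightness and quadraticity *)

Lemma jac_spiked (K : fieldType) (char0 : [pchar K] =i pred0)
    (F : mfamily (free_operad (Linf_gen K)))
    (FD : is_D_multifiltration F) (FE : contains_gen (@eta K (Linf_gen K)) F)
    (n : nat) (d : int) (g : n%:Z - 2 = d) (r : 'I_n.+1) :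
  F _ (spiked r) _ (jac K g).
Proof.
have Fr := mf_subspace FD.1 (spiked r) d.
have nz2 : (2%:R : K) != 0 by rewrite ((pcharf0P K).1 char0).
rewrite jac_sum_block (bigID (fun S : {set _} => r \in S)) /=.
have [F0 Fl] := Fr; rewrite -[X in F _ _ _ (X + _)]scale1r; apply: Fl; last first.
  apply: (subspace_sum Fr) => S /andP[S0 rS].
  have [Se|[x xS]] := set_0Vmem S; first by rewrite Se eqxx in S0.
  have [a [s _ sS]] := set_inner_set xS; rewrite -sS in rS *.
  rewrite jac_blockE; apply: (subspace_scale _ Fr).
  exact: ell_comp_filtration.
pose phi (S : {set 'I_n.+1}) := r |: ~: S.
have phiK (S : {set 'I_n.+1}) : r \in S -> phi (phi S) = S.
  move=> rS; apply/setP => x; rewrite !inE negb_or negbK.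
  by case: eqVneq => [->|].
rewrite (eq_bigl (fun S : {set 'I_n.+1} => r \in S)); last first.
  by move=> S; case rS: (r \in S); rewrite ?andbF ?andbT //; apply/set0Pn; exists r.
set U := \sum_(S | _) _.
(* Reindexing [U] along the involution [phi] writes 2U as the sum over all pairs. *)
have UE : U = 2%:R^-1 *:
    \sum_(S : {set 'I_n.+1} | r \in S) (jac_block K g S + jac_block K g (phi S)).
  have UU : U = \sum_(S : {set 'I_n.+1} | r \in S) jac_block K g (phi S).
    rewrite /U (reindex_onto phi phi) => [|S rS]; last exact: phiK.
    apply: eq_bigl => S; rewrite {1}/phi setU11 /=.
    apply/eqP/idP => [<-|/phiK //]; exact: setU11.
  rewrite big_split /= -UU -/U -mulr2n.
  by rewrite -[U *+ 2]scaler_nat scalerA mulVf ?scale1r.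
rewrite UE; apply: (subspace_scale _ Fr); apply: (subspace_sum Fr) => S rS.
have [a [s sr sS]] := set_inner_set rS.
have [b [t _ tS]] := set_inner_set (setU11 r (~: S) : r \in phi S).
(* S and [phi S] cover everything and meet only in r, so their sizes a + 1 and b + 1 add up to n +
   2. *)
have abn : (b + a)%N = n.
  have Sa : #|S| = a.+1 by rewrite -sS card_inner_set // -ltnS.
  have Sc : #|~: S| = (n - a)%N by have := cardsC S; rewrite card_ord Sa; lia.
  have := cardsU1 r (~: S); rewrite inE negbK rS Sc -[r |: ~: S]tS.
  by have := ltn_ord a; rewrite card_inner_set -?[(b <= n)%N]ltnS //; lia.
have ban : (a + b)%N = n by rewrite addnC.
have gab : (b%:Z - 1) + (a%:Z - 1) = d by lia.
have gba : (a%:Z - 1) + (b%:Z - 1) = d by lia.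
rewrite -tS -sS !jac_blockE (jac_termE K g abn gab) (jac_termE K g ban gba) -sr.
by apply: ell_comp_swap => //; rewrite tS sr sS.
Qed.

Lemma saturated_spiked (K : fieldType) (P : operad K) (F : mfamily P)
    (n : nat) (d : int) (x : P n d) :
  saturated F -> (forall r : 'I_n.+1, F n (spiked r) d x) -> F n (mi_const n 1) d x.
Proof.
(* [p k] is the minimum of the spiked indices at 0, ..., k; saturation is binary, so the spikes are
   intersected one at a time. *)
move=> Fs Fx; pose p k : mindex n := [ffun r : 'I_n.+1 => if (r <= k)%N then 1 else 2].
have -> : mi_const n 1 = p n.
  by apply/ffunP => r; rewrite !ffunE -ltnS ltn_ord.
suff Fp k : (k <= n)%N -> F n (p k) d x by apply: Fp.
elim: k => [_|k IH kn].
  have -> : p 0%N = spiked ord0 by apply/ffunP => r; rewrite !ffunE leqn0 -val_eqE.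
  exact: Fx.
have -> : p k.+1 = mi_min (p k) (spiked (inord k.+1)).
  apply/ffunP => r; rewrite !ffunE -val_eqE /= inordK //.
  by rewrite [(r <= k.+1)%N]leq_eqVlt ltnS; case: eqP => [->|_];
    [rewrite ltnn|case: ifP].
by apply/Fs; split; [apply: IH; apply: ltnW|apply: Fx].
Qed.

Lemma jac_quadratic (K : fieldType) (n : nat) (d : int) (g : n%:Z - 2 = d) :
  quadratic_part (jac K g).
Proof.
move=> W Wl Wq; apply: (subspace_sum Wl) => a _; apply: (subspace_sum Wl) => s _.
apply: (subspace_scale _ Wl); apply: Wq.
by do 4 eexists; exists (jac_arity a), (jac_degree a g), ord0; do 3 eexists.
Qed.

Theorem proposition3p13 (K : fieldType) (char0 : [pchar K] =i pred0) :
  tight_quadratic (@Linf_iota K).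
Proof.
exists (@Linf_rel K); split.
- split.
    move=> n d; split=> [W [] //|c x y Sx Sy W Wl Wj].
    by apply: Wl.2; [apply: Sx|apply: Sy].
  (* [Linf] is by construction the quotient of the free operad, so the projection is the required
     morphism. *)
  exists (@quo_proj _ _ _ (ideal_gen_is_ideal (@Linf_rel K))); split=> //.
  + exact: quo_proj_morphism.
  + exact: quo_proj_surj.
  + exact: quo_proj_ker.
- move=> n d x Rx F FD Fs FE.
  apply: Rx; first exact: (mf_subspace FD.1).
  by move=> _ [g ->]; apply: (saturated_spiked Fs) => r; apply: jac_spiked.
- move=> n d x Rx W Wl Wq; apply: Rx => // _ [g ->].
  exact: jac_quadratic.
Qed.
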